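(* Let $\mathcal{A}$ be an order-enriched category and let $\mathcal{Q}$ be a quantaloid. Then there exists a 2-functor $F:\mathcal{A}\rightarrow\mathcal{Q}$ such that $(F,\mathcal{Q})$ is a quantaloidal completion of $\mathcal{A}$ if and only if there is a compatible nucleus $j$ on $\mathcal{P}(\mathcal{A})$ such that $\mathcal{Q}$ is quantaloidally isomorphic to $\mathcal{P}(\mathcal{A})_{j}$.
   Context: For a category $\mathcal{C}$, $\mathcal{C}_0$ denotes its class of objects and $\mathcal{C}(a,b)$ its hom-sets. An order-enriched category is a locally small category whose hom-sets are posets and whose composition preserves order in both variables. A quantaloid is a locally small category whose hom-sets are complete lattices and whose composition preserves arbitrary suprema in each variable. A 2-functor between order-enriched categories is a functor that is order-preserving on each hom-set. A quantaloidal homomorphism between quantaloids is a functor preserving arbitrary suprema on each hom-set; a quantaloidal isomorphism is a quantaloidal homomorphism that is bijective on objects and on hom-sets. In a poset, $\downarrow f=\{x\mid x\le f\}$. Quantaloidal completion: for $\mathcal{A}$ an order-enriched category, $\mathcal{Q}$ a quantaloid and $F:\mathcal{A}\to\mathcal{Q}$ a 2-functor, $(F,\mathcal{Q})$ is a quantaloidal completion of $\mathcal{A}$ if (1) $F:\mathcal{A}_0\to\mathcal{Q}_0$ is bijective; (2) $F_{a,b}:\mathcal{A}(a,b)\to\mathcal{Q}(Fa,Fb)$ is an order embedding for all $a,b\in\mathcal{A}_0$; (3) for all $a,b\in\mathcal{A}_0$ and $f\in\mathcal{Q}(Fa,Fb)$ there is $U_f\subseteq\mathcal{A}(a,b)$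 with $f=\bigvee F(U_f)$. The quantaloid $\mathcal{P}(\mathcal{A})$ has the same objects as $\mathcal{A}$; $\mathcal{P}(\mathcal{A})(a,b)$ is the power set of $\mathcal{A}(a,b)$ ordered by inclusion; composition is $T\circ S=\{g\circ f\mid g\in T, f\in S\}$; the identity on $a$ is $\{1_a\}$. A lax functor between order-enriched categories consists of an object map and order-preserving hom-maps with $F(g)\circ F(f)\le F(g\circ f)$ and $1_{Fa}\le F(1_a)$. A quantaloidal nucleus on a quantaloid $\mathcal{R}$ is a lax functor $j:\mathcal{R}\to\mathcal{R}$ that is the identity on objects and satisfies $f\le j_{a,b}(f)$, $j_{a,b}(j_{a,b}(f))=j_{a,b}(f)$ and $j_{b,c}(g)\circ j_{a,b}(f)\le j_{a,c}(g\circ f)$ for all $f\in\mathcal{R}(a,b)$, $g\in\mathcal{R}(b,c)$. Then $\mathcal{R}_j$ denotes the quantaloid with the same objects as $\mathcal{R}$, hom-sets $\mathcal{R}_j(a,b)=\{f\in\mathcal{R}(a,b)\mid j_{a,b}(f)=f\}$ (with the induced order), composition $g\circ_j f=j_{a,c}(g\circ f)$, and identities $j_{a,a}(1_a)$. A compatible nucleus on $\mathcal{P}(\mathcal{A})$ is a quantaloidal nucleus $j$ on $\mathcal{P}(\mathcal{A})$ such that $j_{a,b}(\{f\})=\downarrow f$ for all $a,b\in\mathcal{A}_0$ and $f\in\mathcal{A}(a,b)$. *)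

(* Defs.v *)
From HB Require Import structures.
From mathcomp Require Import all_boot all_order.
From mathcomp Require Import boolp classical_sets.

Set Implicit Arguments.
Unset Strict Implicit.
Unset Printing Implicit Defensive.

Import Order.TTheory.
Local Open Scope order_scope.
Local Open Scope classical_set_scope.

Reserved Notation "g ∘ f" (at level 40, left associativity).

(* [hom_display] only selects the printing of the order on the hom-sets. *)
Record orderEnrichedCat := OrderEnrichedCat {
  ob :> Type;
  hom_display : Order.disp_t;
  hom : ob -> ob -> porderType hom_display;
  idm : forall a, hom a a;
  comp : forall a b c, hom b c -> hom a b -> hom a c;
  comp1m : forall a b (f : hom a b), comp (idm b) f = f;
  compm1 : forall a b (f : hom a b), comp f (idm a) = f;
  compA : forall a b c d (h : hom c d) (g : hom b c) (f : hom a b),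
    comp h (comp g f) = comp (comp h g) f;
  le_comp : forall a b c (g g' : hom b c) (f f' : hom a b),
    g <= g' -> f <= f' -> comp g f <= comp g' f'
}.

Coercion hom : orderEnrichedCat >-> Funclass.
Arguments hom : clear implicits.
Arguments idm {o} a.
Notation "g ∘ f" := (comp g f).

Definition complete_lattice d (T : porderType d) : Prop :=
  forall U : set T, supremums U !=set0 /\ infimums U !=set0.

Record quantaloid := Quantaloid {
  quantaloid_cat :> orderEnrichedCat;
  hom_complete : forall a b : quantaloid_cat,
    complete_lattice (quantaloid_cat a b);
  comp_supl : forall (a b c : quantaloid_cat) (G : set (quantaloid_cat b c))
      (s : quantaloid_cat b c) (f : quantaloid_cat a b),
    supremums G s -> supremums [set g ∘ f | g in G] (s ∘ f);
  comp_supr : forall (a b c : quantaloid_cat) (g : quantaloid_cat b c)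
      (U : set (quantaloid_cat a b)) (s : quantaloid_cat a b),
    supremums U s -> supremums [set g ∘ f | f in U] (g ∘ s)
}.

(* The conditions below are stated on the pair [Fo], [F] of an object map and a
   family of hom-maps, so that an endofunctor that is the identity on objects
   is one whose object map is literally [id]. *)
Section Functors.
Variables (A B : orderEnrichedCat) (Fo : A -> B).
Variable F : forall a b, A a b -> B (Fo a) (Fo b).

Definition monotone_on_homs : Prop :=
  forall (a b : A) (f g : A a b), f <= g -> F f <= F g.

Definition is_functor : Prop :=
  (forall a, F (idm a) = idm (Fo a)) /\
  (forall a b c (g : A b c) (f : A a b), F (g ∘ f) = F g ∘ F f).

Definition is_lax_functor : Prop :=
  [/\ monotone_on_homs,
      forall a b c (g : A b c) (f : A a b), F g ∘ F f <= F (g ∘ f) &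
      forall a, idm (Fo a) <= F (idm a)].

Definition preserves_suprema : Prop :=
  forall (a b : A) (U : set (A a b)) (s : A a b),
    supremums U s -> supremums (@F a b @` U) (F s).

End Functors.

Record twoFunctor (A B : orderEnrichedCat) := TwoFunctor {
  on_ob :> A -> B;
  on_hom : forall a b, A a b -> B (on_ob a) (on_ob b);
  twoFunctor_functor : is_functor on_hom;
  twoFunctor_monotone : monotone_on_homs on_hom
}.
Arguments on_hom {A B} t {a b} f.

Record quantaloidalHom (Q R : quantaloid) := QuantaloidalHom {
  qon_ob :> Q -> R;
  qon_hom : forall a b, Q a b -> R (qon_ob a) (qon_ob b);
  quantaloidalHom_functor : is_functor qon_hom;
  quantaloidalHom_sup : preserves_suprema qon_hom
}.
Arguments qon_hom {Q R} q {a b} f.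

Definition quantaloidally_isomorphic (Q R : quantaloid) : Prop :=
  exists F : quantaloidalHom Q R,
    bijective F /\ forall a b : Q, bijective (@qon_hom Q R F a b).

Definition quantaloidal_completion (A : orderEnrichedCat) (Q : quantaloid)
    (F : twoFunctor A Q) : Prop :=
  [/\ bijective F,
      forall a b : A, {mono @on_hom A Q F a b : f g / f <= g} &
      forall (a b : A) (f : Q (F a) (F b)),
        exists U : set (A a b), supremums (on_hom F @` U) f].

Lemma complete_lattice_sup d (T : porderType d) :
  (forall U : set T, supremums U !=set0) -> complete_lattice T.
Proof.
move=> supT U; split=> //; have [x [xub xle]] := supT (lbound U).
exists x; split; first by move=> y Uy; apply: xle => z; apply.
by move=> y /xub.
Qed.

Section PowerQuantaloid.
Variable A : orderEnrichedCat.

Definition pcomp (a b c : A) (T : set (A b c)) (S : set (A a b)) :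
    set (A a c) := [set g ∘ f | g in T & f in S].

Fact pcomp1m (a b : A) (S : set (A a b)) : pcomp [set idm b] S = S.
Proof.
apply/seteqP; split=> [_ [_ -> [f Sf <-]]|f Sf]; first by rewrite comp1m.
by exists (idm b) => //; exists f => //; rewrite comp1m.
Qed.

Fact pcompm1 (a b : A) (S : set (A a b)) : pcomp S [set idm a] = S.
Proof.
apply/seteqP; split=> [_ [f Sf [_ -> <-]]|f Sf]; first by rewrite compm1.
by exists f => //; exists (idm a) => //; rewrite compm1.
Qed.

Fact pcompA (a b c d : A) (V : set (A c d)) (T : set (A b c))
    (S : set (A a b)) : pcomp V (pcomp T S) = pcomp (pcomp V T) S.
Proof.
apply/seteqP; split=> [_ [h Vh [_ [g Tg [f Sf <-]] <-]]|].
  by exists (h ∘ g); [exists h => //; exists g | exists f => //; rewrite compA].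
move=> _ [_ [h Vh [g Tg <-]] [f Sf <-]].
by exists h => //; exists (g ∘ f); [exists g => //; exists f | rewrite compA].
Qed.

Fact le_pcomp (a b c : A) (T T' : set (A b c)) (S S' : set (A a b)) :
  T <= T' -> S <= S' -> pcomp T S <= pcomp T' S'.
Proof.
rewrite !subsetEset => TT' SS' _ [g Tg [f Sf <-]].
by exists g; [exact: TT' | exists f; [exact: SS' |]].
Qed.

Definition powerCat : orderEnrichedCat :=
  @OrderEnrichedCat A set_display (fun a b => set (A a b))
    (fun a => [set idm a]) pcomp pcomp1m pcompm1 pcompA le_pcomp.

Fact bigcup_supremums (T : Type) (F : set (set T)) :
  supremums F (\bigcup_(S in F) S).
Proof.
split=> [S FS|V Vub]; rewrite subsetEset; first exact: bigcup_sup.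
by apply: bigcup_sub => S /Vub; rewrite subsetEset.
Qed.

Fact supremums_bigcup (T : Type) (F : set (set T)) (V : set T) :
  supremums F V -> V = \bigcup_(S in F) S.
Proof. by move=> FV; apply: (is_subset1_supremums FV (bigcup_supremums F)). Qed.

Fact powerCat_complete (a b : powerCat) : complete_lattice (powerCat a b).
Proof.
by apply: complete_lattice_sup => F; eexists; apply: bigcup_supremums.
Qed.

Fact powerCat_supl (a b c : powerCat) (G : set (powerCat b c))
    (s : powerCat b c) (f : powerCat a b) :
  supremums G s -> supremums [set g ∘ f | g in G] (s ∘ f).
Proof.
move=> /supremums_bigcup ->; split=> [_ [g Gg <-]|V Vub].
  by apply: le_comp => //; rewrite subsetEset; apply: bigcup_sup.
rewrite subsetEset => _ [y [g Gg gy] [x fx <-]].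
have /Vub := imageP (fun g => @comp powerCat a b c g f) Gg.
by rewrite subsetEset; apply; exists y => //; exists x.
Qed.

Fact powerCat_supr (a b c : powerCat) (g : powerCat b c)
    (U : set (powerCat a b)) (s : powerCat a b) :
  supremums U s -> supremums [set g ∘ f | f in U] (g ∘ s).
Proof.
move=> /supremums_bigcup ->; split=> [_ [f Uf <-]|V Vub].
  by apply: le_comp => //; rewrite subsetEset; apply: bigcup_sup.
rewrite subsetEset => _ [y gy [x [f Uf fx] <-]].
have /Vub := imageP (@comp powerCat a b c g) Uf.
by rewrite subsetEset; apply; exists y => //; exists x.
Qed.

Definition powerQuantaloid : quantaloid :=
  Quantaloid powerCat_complete powerCat_supl powerCat_supr.

End PowerQuantaloid.

Record nucleus (R : quantaloid) := Nucleus {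
  nucleus_map :> forall a b : R, R a b -> R a b;
  nucleus_lax : @is_lax_functor R R id nucleus_map;
  nucleus_le : forall a b (f : R a b), f <= nucleus_map f;
  nucleus_idem : forall a b (f : R a b),
    nucleus_map (nucleus_map f) = nucleus_map f;
  nucleus_comp : forall a b c (g : R b c) (f : R a b),
    nucleus_map g ∘ nucleus_map f <= nucleus_map (g ∘ f)
}.
Arguments nucleus_map {R} n {a b} f.

Definition fixpoints d (T : porderType d) (k : T -> T) := {x : T | k x == x}.

HB.instance Definition _ d (T : porderType d) (k : T -> T) :=
  SubChoice.on (fixpoints k).
HB.instance Definition _ d (T : porderType d) (k : T -> T) :=
  [SubChoice_isSubPOrder of fixpoints k by <: with d].

Section FixedQuantaloid.
Variables (R : quantaloid) (j : nucleus R).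

Fact le_nucleus (a b : R) (f g : R a b) : f <= g -> j a b f <= j a b g.
Proof. by case: (nucleus_lax j) => + _ _; apply. Qed.

Definition fhom (a b : R) : porderType (hom_display R) := fixpoints (j a b).

Fact fhomE (a b : R) (f : fhom a b) : j a b (val f) = val f.
Proof. exact/eqP/(valP f). Qed.

Definition close (a b : R) (f : R a b) : fhom a b :=
  exist _ (j a b f) (introT eqP (nucleus_idem j f)).

Definition fidm (a : R) : fhom a a := close (idm a).
Definition fcomp (a b c : R) (g : fhom b c) (f : fhom a b) : fhom a c :=
  close (val g ∘ val f).

Fact nucleus_min (a b : R) (f : R a b) (h : fhom a b) :
  (j a b f <= val h) = (f <= val h).
Proof.
apply/idP/idP => [|fh]; first exact/le_trans/nucleus_le.
by rewrite -(fhomE h) le_nucleus.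
Qed.

Fact le_close (a b : R) (f : R a b) (h : fhom a b) :
  (close f <= h) = (f <= val h).
Proof. exact: nucleus_min. Qed.

Fact nucleus_compl (a b c : R) (g : R b c) (f : fhom a b) :
  j a c (j b c g ∘ val f) = j a c (g ∘ val f).
Proof.
apply/le_anti/andP; split; last first.
  by apply/le_nucleus/le_comp => //; apply: nucleus_le.
rewrite -(nucleus_idem j (g ∘ val f)) le_nucleus// -{1}(fhomE f).
exact: nucleus_comp.
Qed.

Fact nucleus_compr (a b c : R) (g : fhom b c) (f : R a b) :
  j a c (val g ∘ j a b f) = j a c (val g ∘ f).
Proof.
apply/le_anti/andP; split; last first.
  by apply/le_nucleus/le_comp => //; apply: nucleus_le.
rewrite -(nucleus_idem j (val g ∘ f)) le_nucleus// -{1}(fhomE g).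
exact: nucleus_comp.
Qed.

Fact fcomp1m (a b : R) (f : fhom a b) : fcomp (fidm b) f = f.
Proof. by apply: val_inj; rewrite /= nucleus_compl comp1m fhomE. Qed.

Fact fcompm1 (a b : R) (f : fhom a b) : fcomp f (fidm a) = f.
Proof. by apply: val_inj; rewrite /= nucleus_compr compm1 fhomE. Qed.

Fact fcompA (a b c d : R) (h : fhom c d) (g : fhom b c) (f : fhom a b) :
  fcomp h (fcomp g f) = fcomp (fcomp h g) f.
Proof. by apply: val_inj; rewrite /= nucleus_compl nucleus_compr compA. Qed.

Fact le_fcomp (a b c : R) (g g' : fhom b c) (f f' : fhom a b) :
  g <= g' -> f <= f' -> fcomp g f <= fcomp g' f'.
Proof. by move=> gg' ff'; apply/le_nucleus/le_comp. Qed.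

Definition fixedCat : orderEnrichedCat :=
  OrderEnrichedCat fcomp1m fcompm1 fcompA le_fcomp.

Fact close_supremums (a b : R) (U : set (fhom a b)) (u : R a b) :
  supremums (val @` U) u -> supremums U (close u).
Proof.
move=> [uub ule]; split=> [x Ux|x xub].
  by apply: le_trans (nucleus_le j u); apply: uub; exists x.
rewrite le_close; apply: ule => _ [y Uy <-]; exact: xub.
Qed.

Fact supremums_close (a b : R) (U : set (fhom a b)) (s : fhom a b) :
  supremums U s -> exists2 u, supremums (val @` U) u & s = close u.
Proof.
move=> Us; have [[u Uu] _] := hom_complete (val @` U).
by exists u => //; apply: (is_subset1_supremums Us (close_supremums Uu)).
Qed.

Fact fixedCat_complete (a b : fixedCat) : complete_lattice (fixedCat a b).
Proof.
apply: complete_lattice_sup => U; have [[u Uu] _] := hom_complete (val @` U).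
by exists (close u); apply: close_supremums.
Qed.

Fact fixedCat_supl (a b c : fixedCat) (G : set (fixedCat b c))
    (s : fixedCat b c) (f : fixedCat a b) :
  supremums G s -> supremums [set g ∘ f | g in G] (s ∘ f).
Proof.
move=> Gs; split=> [_ [g Gg <-]|x xub].
  by apply: le_comp => //; case: Gs => + _; apply.
have [u Gu ->] := supremums_close Gs.
have -> : @comp fixedCat a b c (close u) f = close (u ∘ val f).
  by apply: val_inj; apply: nucleus_compl.
rewrite [_ <= _]le_close.
have [_] := comp_supl (val f) Gu; apply=> _ [_ [g Gg <-] <-].
by rewrite -le_close; apply: xub; exists g.
Qed.

Fact fixedCat_supr (a b c : fixedCat) (g : fixedCat b c)
    (U : set (fixedCat a b)) (s : fixedCat a b) :
  supremums U s -> supremums [set g ∘ f | f in U] (g ∘ s).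
Proof.
move=> Us; split=> [_ [f Uf <-]|x xub].
  by apply: le_comp => //; case: Us => + _; apply.
have [u Uu ->] := supremums_close Us.
have -> : @comp fixedCat a b c g (close u) = close (val g ∘ u).
  by apply: val_inj; apply: nucleus_compr.
rewrite [_ <= _]le_close.
have [_] := comp_supr (val g) Uu; apply=> _ [_ [f Uf <-] <-].
by rewrite -le_close; apply: xub; exists f.
Qed.

Definition fixedQuantaloid : quantaloid :=
  Quantaloid fixedCat_complete fixedCat_supl fixedCat_supr.

End FixedQuantaloid.

Definition compatible (A : orderEnrichedCat)
    (j : nucleus (powerQuantaloid A)) : Prop :=
  forall (a b : A) (f : A a b), j a b [set f] = [set x | x <= f].

(* Main.v *)
Require Import Defs.
From mathcomp Require Import all_boot all_order.
From mathcomp Require Import boolp classical_sets.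

(** A completion [F : A -> Q] yields, on each pair of objects, an adjunction
    between sets of arrows of [A] and arrows of [Q]: the join [S |-> \/ F S] is
    left adjoint to the trace [q |-> {x | F x <= q}].  The closure operator of
    the adjunction is a nucleus because composition in [Q] distributes over
    joins ([comp_join]); it is compatible because [F] is an order embedding
    ([compatible_completion_nucleus]).  Density of [F] says that every [q] is
    the join of its trace, so the join restricts to an order isomorphism from
    closed sets onto arrows of [Q], and this restriction is functorial
    ([fixed_completion_iso]).

    Conversely, if [j] is compatible, [f |-> ↓f = j {f}] embeds [A] into the
    fixed points of [j], where every closed set is the join of the principal
    down-sets of its elements ([principal_completion]).  Completions are carried
    along quantaloidal isomorphisms ([completion_iso]).

    Both constructions relate [Q] to the fixed points by a homomorphism going
    from the fixed points to [Q], whereas the isomorphism is asked for in the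
    other direction; this is bridged by the symmetry of isomorphism
    ([quantaloidally_isomorphic_sym]). *)

Set Implicit Arguments.
Unset Strict Implicit.
Unset Printing Implicit Defensive.

Import Order.TTheory.
Local Open Scope order_scope.
Local Open Scope classical_set_scope.

(** * Suprema and order embeddings *)

Lemma supremums_le d (T : porderType d) (U : set T) (s x : T) :
  supremums U s -> (s <= x <-> ubound U x).
Proof.
move=> [Us sU]; split=> [sx y Uy|]; last exact: sU.
exact: le_trans (Us y Uy) sx.
Qed.

Lemma supremums_pair d (T : porderType d) (x y : T) :
  supremums [set x; y] y <-> x <= y.
Proof.
split=> [[ub _]|xy]; first by apply: ub; left.
by split=> [_ [->|->] //|z]; apply; right.
Qed.

Section OrderEmbeddings.
Variables (d d' : Order.disp_t) (T : porderType d) (T' : porderType d').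

Lemma mono_supremums (f : T -> T') (U : set T) (s : T) :
  bijective f -> {mono f : x y / x <= y} ->
  supremums U s -> supremums (f @` U) (f s).
Proof.
move=> [g fK gK] f_mono [Us sU]; split=> [_ [x Ux <-]|y yU].
  by rewrite f_mono; apply: Us.
rewrite -(gK y) f_mono; apply: sU => x Ux.
by rewrite -f_mono gK; apply: yU; exists x.
Qed.

(** The order is determined by binary suprema, [x <= y] meaning that [y] is the
    supremum of [{x, y}]; hence an injection that preserves suprema also
    reflects the order. *)
Lemma supremums_mono (f : T -> T') :
    (forall U : set T, supremums U !=set0) ->
    (forall U s, supremums U s -> supremums (f @` U) (f s)) ->
    injective f ->
  {mono f : x y / x <= y}.
Proof.
move=> supT f_sup f_inj x y; apply/idP/idP => [|/supremums_pair/f_sup].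
  have [s xys] := supT [set x; y].
  have := f_sup _ _ xys; rewrite image_setU !image_set1 => fxys.
  move=> /supremums_pair fxy; apply/supremums_pair.
  by rewrite -{2}(f_inj _ _ (is_subset1_supremums fxys fxy)).
by rewrite image_setU !image_set1 => /supremums_pair.
Qed.

End OrderEmbeddings.

Lemma comp_supremums_le (Q : quantaloid) (a b c : Q) (G : set (Q b c))
    (U : set (Q a b)) (g : Q b c) (f : Q a b) (q : Q a c) :
    supremums G g -> supremums U f ->
    (forall x y, G x -> U y -> x ∘ y <= q) ->
  g ∘ f <= q.
Proof.
move=> Gg Uf GUq; have [_] := comp_supl f Gg; apply=> _ [x Gx <-].
by have [_] := comp_supr x Uf; apply=> _ [y Uy <-]; apply: GUq.
Qed.

(** * Isomorphisms of quantaloids *)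

Lemma qon_hom_mono (Q R : quantaloid) (H : quantaloidalHom Q R) (a b : Q) :
  bijective (@qon_hom Q R H a b) -> {mono @qon_hom Q R H a b : f g / f <= g}.
Proof.
move=> /bij_inj; apply: supremums_mono => [U|U s].
  by have [] := hom_complete U.
exact: quantaloidalHom_sup.
Qed.

(** A bijective order embedding preserves whatever suprema exist, so for a functor
    that is bijective on objects and on hom-sets the order alone decides whether
    it is an isomorphism of quantaloids. *)
Lemma mono_quantaloidally_isomorphic (Q R : quantaloid) (Ho : Q -> R)
    (H : forall a b, Q a b -> R (Ho a) (Ho b)) :
    bijective Ho -> is_functor H ->
    (forall a b, bijective (H a b)) ->
    (forall a b, {mono H a b : f g / f <= g}) ->
  quantaloidally_isomorphic Q R.
Proof.
move=> Ho_bij H_functor H_bij H_mono.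
have H_sup : preserves_suprema H.
  by move=> a b U s; apply: mono_supremums.
by exists (QuantaloidalHom H_functor H_sup).
Qed.

(** Invertible arrows between equal objects.  Conjugating by them replaces the
    transport of arrows along an equation between objects. *)
Lemma eq_ob_iso (A : orderEnrichedCat) (a b : A) : a = b ->
  {u : A a b * A b a | u.1 ∘ u.2 = idm b /\ u.2 ∘ u.1 = idm a}.
Proof. by move=> ->; exists (idm b, idm b); rewrite /= comp1m. Qed.

Section Inverse.
Variables (Q R : quantaloid) (H : quantaloidalHom Q R) (G : R -> Q).
Hypotheses (HK : cancel H G) (GK : cancel G H).
Hypothesis H_bij : forall a b, bijective (@qon_hom Q R H a b).

Let hinv_sig (a b : Q) :
  {g : R (H a) (H b) -> Q a b | cancel (@qon_hom Q R H a b) g /\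
                                cancel g (@qon_hom Q R H a b)}.
Proof. by apply: cid; have [g gK Kg] := H_bij a b; exists g. Qed.

Let hinv (a b : Q) := sval (hinv_sig a b).
Let hinvK (a b : Q) : cancel (@hinv a b) (@qon_hom Q R H a b).
Proof. by have [] := svalP (hinv_sig a b). Qed.
Let homK (a b : Q) : cancel (@qon_hom Q R H a b) (@hinv a b).
Proof. by have [] := svalP (hinv_sig a b). Qed.

Let iso (r : R) := eq_ob_iso (esym (GK r)).
Let into (r : R) : R r (H (G r)) := (sval (iso r)).1.
Let back (r : R) : R (H (G r)) r := (sval (iso r)).2.
Let intoK (r : R) : back r ∘ into r = idm r.
Proof. by have [] := svalP (iso r). Qed.
Let backK (r : R) : into r ∘ back r = idm (H (G r)).
Proof. by have [] := svalP (iso r). Qed.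

Let conj (r s : R) (f : R r s) : R (H (G r)) (H (G s)) :=
  into s ∘ f ∘ back r.
Let unconj (r s : R) (f : R (H (G r)) (H (G s))) : R r s :=
  back s ∘ f ∘ into r.

Let conjK (r s : R) : cancel (@conj r s) (@unconj r s).
Proof.
move=> f; rewrite /conj /unconj !Defs.compA intoK comp1m.
by rewrite -Defs.compA intoK compm1.
Qed.

Let unconjK (r s : R) : cancel (@unconj r s) (@conj r s).
Proof.
move=> f; rewrite /conj /unconj !Defs.compA backK comp1m.
by rewrite -Defs.compA backK compm1.
Qed.

Let conj_mono (r s : R) : {mono @conj r s : f g / f <= g}.
Proof.
move=> f g; apply/idP/idP => fg; last by do 2!apply: le_comp => //.
by rewrite -(conjK f) -(conjK g); do 2!apply: le_comp => //.
Qed.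

(** The inverse of [H] on an arrow [f : r -> s] cannot be read off directly,
    since the hom-maps of [H] take values in [R (H a) (H b)]; [f] is first
    carried to an arrow [H (G r) -> H (G s)]. *)
Lemma inverse_quantaloidally_isomorphic : quantaloidally_isomorphic R Q.
Proof.
have [H1 HM] := quantaloidalHom_functor H.
apply: (@mono_quantaloidally_isomorphic R Q G
          (fun r s f => hinv (conj f))).
- by exists H.
- split=> [r|r s t g f]; first by rewrite /conj compm1 backK -H1 homK.
  rewrite -[RHS]homK HM !hinvK; congr hinv.
  rewrite /conj !Defs.compA -(Defs.compA (into t ∘ g) (back s)).
  by rewrite intoK compm1.
- move=> r s; exists (fun f => unconj (qon_hom H f)) => f.
    by rewrite hinvK conjK.
  by rewrite unconjK homK.
- move=> r s f g; rewrite -(qon_hom_mono (H_bij _ _)) !hinvK.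
  exact: conj_mono.
Qed.

End Inverse.

Lemma quantaloidally_isomorphic_sym (Q R : quantaloid) :
  quantaloidally_isomorphic Q R -> quantaloidally_isomorphic R Q.
Proof.
by move=> [H [[G HK GK] H_bij]]; apply: inverse_quantaloidally_isomorphic H_bij.
Qed.

(** * From a compatible nucleus to a completion *)

(** For density, the set of arrows whose join is [q] is the one provided by [F] for
    the preimage of [q]. *)
Lemma completion_iso (A : orderEnrichedCat) (R Q : quantaloid)
    (F : twoFunctor A R) :
    quantaloidal_completion F -> quantaloidally_isomorphic R Q ->
  exists F' : twoFunctor A Q, quantaloidal_completion F'.
Proof.
move=> [Fo_bij F_mono F_dense] [H [Ho_bij H_bij]].
have [F1 FM] := twoFunctor_functor F.
have [H1 HM] := quantaloidalHom_functor H.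
pose K a b (f : A a b) := qon_hom H (on_hom F f).
have K_functor : is_functor K.
  by split=> [a|a b c g f]; rewrite /K ?F1 ?H1 ?FM ?HM.
have K_mono a b : {mono K a b : f g / f <= g}.
  by move=> f g; rewrite /K qon_hom_mono ?F_mono.
have K_monotone : monotone_on_homs K by move=> a b f g; rewrite K_mono.
exists (TwoFunctor K_functor K_monotone); split=> //=; first exact: bij_comp.
move=> a b q; have [h _ hK] := H_bij (F a) (F b).
have [U Uq] := F_dense a b (h q); exists U.
by rewrite -(hK q) -[_ @` U]image_comp; apply: quantaloidalHom_sup.
Qed.

(** Closing both factors at once; this is what makes [f |-> j {f}] respect
    composition, [{g}] and [{f}] being in general not closed. *)
Lemma nucleus_comp_closed (R : quantaloid) (j : nucleus R) (a b c : R)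
    (g : R b c) (f : R a b) :
  j a c (j b c g ∘ j a b f) = j a c (g ∘ f).
Proof.
apply/le_anti/andP; split; last by apply/le_nucleus/le_comp; apply: nucleus_le.
by rewrite -(nucleus_idem j (g ∘ f)); apply/le_nucleus/nucleus_comp.
Qed.

Section Principal.
Variables (A : orderEnrichedCat) (j : nucleus (powerQuantaloid A)).
Hypothesis j_compat : compatible j.

Let principal (a b : A) (f : A a b) : fixedQuantaloid j a b :=
  @close _ j a b [set f].

Let le_principal (a b : A) (f : A a b) (S : fixedQuantaloid j a b) :
  principal f <= S <-> val S f.
Proof.
have -> : (principal f <= S) = ([set f] <= val S).
  exact: (@le_close _ j a b [set f] S).
rewrite subsetEset; by split=> [/(_ f)|Sf _ ->]; [apply|].
Qed.

Let principal_mono (a b : A) : {mono @principal a b : f g / f <= g}.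
Proof.
move=> f g; apply/idP/idP => [/le_principal|fg].
  by rewrite /= j_compat.
by apply/le_principal; rewrite /= j_compat.
Qed.

Let principal_functor : @is_functor A (fixedQuantaloid j) id principal.
Proof.
split=> // a b c g f; apply: val_inj => /=.
rewrite [RHS](@nucleus_comp_closed (powerQuantaloid A) j a b c [set g] [set f]).
congr (j a c _); apply/seteqP.
by split=> [_ ->|_ [_ -> [_ -> <-]] //]; exists g => //; exists f.
Qed.

(** A closed set [S] is the join of the principal down-sets of its own elements,
    because [j {f}] lies below [S] exactly when [f] is an element of [S]. *)
Lemma principal_completion :
  exists F : twoFunctor A (fixedQuantaloid j), quantaloidal_completion F.
Proof.
have monot : @monotone_on_homs A (fixedQuantaloid j) id principal.
  by move=> a b f g; rewrite principal_mono.
exists (TwoFunctor principal_functor monot); split=> //=; first by exists id.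
move=> a b S; exists (val S); split=> [_ [f Sf <-]|T Tub].
  exact/le_principal.
change (is_true (val S <= val T)); rewrite subsetEset => f Sf.
by apply/le_principal/Tub; exists f.
Qed.

End Principal.

(** * From a completion to a compatible nucleus *)

Section Completion.
Variables (A : orderEnrichedCat) (Q : quantaloid) (F : twoFunctor A Q).
Hypothesis F_compl : quantaloidal_completion F.

Let Fo_bij : bijective F. Proof. by case: F_compl. Qed.
Let F_mono (a b : A) : {mono @on_hom A Q F a b : f g / f <= g}.
Proof. by case: F_compl. Qed.
Let F1 (a : A) : on_hom F (idm a) = idm (F a).
Proof. by case: (twoFunctor_functor F). Qed.
Let FM (a b c : A) (g : A b c) (f : A a b) :
  on_hom F (g ∘ f) = on_hom F g ∘ on_hom F f.
Proof. by case: (twoFunctor_functor F). Qed.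

Let join_sig (a b : A) (S : set (A a b)) :
  {q : Q (F a) (F b) | supremums (on_hom F @` S) q}.
Proof. by apply: cid; have [] := hom_complete (on_hom F @` S). Qed.

Let join (a b : A) (S : set (A a b)) := sval (join_sig S).
Let trace (a b : A) (q : Q (F a) (F b)) := [set x : A a b | on_hom F x <= q].

Let joinP (a b : A) (S : set (A a b)) : supremums (on_hom F @` S) (join S).
Proof. exact: svalP (join_sig S). Qed.

Let join_ub (a b : A) (S : set (A a b)) (f : A a b) :
  S f -> on_hom F f <= join S.
Proof. by move=> Sf; have [+ _] := joinP S; apply; exists f. Qed.

Let join_trace_adj (a b : A) (S : set (A a b)) (q : Q (F a) (F b)) :
  join S <= q <-> S `<=` trace q.
Proof.
rewrite (supremums_le q (joinP S)); split=> [ub x Sx|sub _ [x Sx <-]].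
  by apply: ub; exists x.
exact: sub.
Qed.

(** This is density: any [U] with [q = \/ F U] consists of elements of the trace
    of [q], and so the trace, although it may be larger than [U], has join [q]
    too. *)
Let traceK (a b : A) (q : Q (F a) (F b)) : join (trace q) = q.
Proof.
have [_ _ /(_ a b q) [U Uq]] := F_compl.
apply/le_anti/andP; split; first exact/join_trace_adj.
apply/(supremums_le _ Uq) => _ [x Ux <-].
by apply: join_ub; have [+ _] := Uq; apply; exists x.
Qed.

Let join1 (a b : A) (f : A a b) : join [set f] = on_hom F f.
Proof.
have := joinP [set f]; rewrite image_set1 => sup_f.
by apply: (is_subset1_supremums sup_f); split=> [_ -> //|y]; apply.
Qed.

(** The inequality from left to right is distributivity of composition over joins
    in [Q], applied in both variables; it makes the closure operator of the
    adjunction a nucleus. *)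
Let comp_join (a b c : A) (T : set (A b c)) (S : set (A a b)) :
  join T ∘ join S = join (Defs.pcomp T S).
Proof.
apply/le_anti/andP; split; last first.
  apply/join_trace_adj => _ [g Tg [f Sf <-]]; rewrite /trace /= FM.
  by apply: le_comp; apply: join_ub.
apply: comp_supremums_le (joinP T) (joinP S) _ => _ _ [g Tg <-] [f Sf <-].
by rewrite -FM; apply: join_ub; exists g => //; exists f.
Qed.

Let closure (a b : powerQuantaloid A) (S : powerQuantaloid A a b) :
  powerQuantaloid A a b := trace (join S).

Let closure_min (a b : powerQuantaloid A) (S T : powerQuantaloid A a b) :
  (S <= closure T) = (join S <= join T).
Proof. by apply/idP/idP; rewrite subsetEset => /join_trace_adj. Qed.

Let join_closure (a b : powerQuantaloid A) (S : powerQuantaloid A a b) :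
  join (closure S) = join S.
Proof. exact: traceK. Qed.

Let le_closure (a b : powerQuantaloid A) (S : powerQuantaloid A a b) :
  S <= closure S.
Proof. by rewrite closure_min. Qed.

Let closure_idem (a b : powerQuantaloid A) (S : powerQuantaloid A a b) :
  closure (closure S) = closure S.
Proof. by rewrite /closure traceK. Qed.

Let closure_monotone : @monotone_on_homs (powerQuantaloid A) _ id closure.
Proof.
by move=> a b S T ST; rewrite closure_min join_closure -closure_min
  (le_trans ST).
Qed.

Let closure_comp (a b c : powerQuantaloid A) (T : powerQuantaloid A b c)
    (S : powerQuantaloid A a b) :
  closure T ∘ closure S <= closure (T ∘ S).
Proof. by rewrite closure_min -!comp_join !join_closure. Qed.

Let closure_lax : @is_lax_functor (powerQuantaloid A) _ id closure.
Proof. by split=> [|a b c|a]; [|apply: closure_comp|apply: le_closure]. Qed.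

Definition completion_nucleus : nucleus (powerQuantaloid A) :=
  Nucleus closure_lax le_closure closure_idem closure_comp.

(** The closure of [{f}] is the trace of [F f], which is the down-set of [f] since
    [F] reflects the order. *)
Lemma compatible_completion_nucleus : compatible completion_nucleus.
Proof.
move=> a b f; rewrite /= /closure join1.
by apply/seteqP; split=> x; rewrite /trace /= F_mono.
Qed.

(** Closed sets are the fixed points of the adjunction on the side of [A], and by
    density every arrow of [Q] is a fixed point on the other side; the join and
    the trace are therefore mutually inverse between them. *)
Lemma fixed_completion_iso :
  quantaloidally_isomorphic (fixedQuantaloid completion_nucleus) Q.
Proof.
pose P_j := fixedQuantaloid completion_nucleus.
apply: (@mono_quantaloidally_isomorphic P_j Q F
          (fun a b (S : P_j a b) => join (val S))) => //.
- split=> [a|a b c T S] /=; rewrite join_closure; first by rewrite join1 F1.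
  by rewrite comp_join.
- move=> a b; exists (fun q => @close _ completion_nucleus a b (trace q)).
    move=> S; apply: val_inj => /=; rewrite /closure traceK.
    exact: (fhomE S).
  by move=> q /=; rewrite join_closure traceK.
- move=> a b S T; rewrite -closure_min -[closure _]/(completion_nucleus a b _).
  by rewrite fhomE.
Qed.

End Completion.

Theorem theorem3p9 (A : orderEnrichedCat) (Q : quantaloid) :
  (exists F : twoFunctor A Q, quantaloidal_completion F) <->
  (exists j : nucleus (powerQuantaloid A),
     compatible j /\ quantaloidally_isomorphic Q (fixedQuantaloid j)).
Proof.
split=> [[F F_compl]|[j [j_compat Q_iso]]].
  exists (completion_nucleus F_compl); split.
    exact: compatible_completion_nucleus.
  exact/quantaloidally_isomorphic_sym/fixed_completion_iso.
have [F F_compl] := principal_completion j_compat.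
exact: completion_iso F_compl (quantaloidally_isomorphic_sym Q_iso).
Qed.
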